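(* Let $\alpha,\epsilon>0$ be real numbers. The set $\chi_{\epsilon,\alpha}\cap(1+\frac{1}{2\epsilon},\infty)$ is dense in $(1+\frac{1}{2\epsilon},\infty)$. For any real $a,b$ with $b>\max\{a,1+\frac1\epsilon\}$, the set $\chi_{\epsilon,\alpha}\cap(a,b)$ has the cardinality of $\mathbb{R}$.
   Context: For real $x$, $\Vert x\Vert$ denotes the distance from $x$ to the nearest integer. For real $\alpha\neq 0$ and $\epsilon>0$, $\chi_{\epsilon,\alpha}$ denotes the set of all real $\zeta>1$ such that $\Vert\alpha\zeta^n\Vert\leq\epsilon$ for all integers $n\geq n_0$, for some integer $n_0=n_0(\alpha,\zeta,\epsilon)$. *)

(* Defs.v *)
From mathcomp Require Import all_boot all_order all_algebra.
From mathcomp Require Import all_classical all_reals all_analysis.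

Set Implicit Arguments.
Unset Strict Implicit.
Unset Printing Implicit Defensive.

Import Order.TTheory GRing.Theory Num.Theory.
Import numFieldNormedType.Exports.

Local Open Scope classical_set_scope.
Local Open Scope ring_scope.

Definition dist_int (R : realType) (x : R) : R :=
  inf (range (fun m : int => `|x - m%:~R|)).

(* The exponent [n] ranges over all integers past [n0], and [n0] may be
   negative: [zeta ^ n] is the integer power [exprz], with [zeta != 0] here. *)
Definition chi (R : realType) (eps alpha : R) : set R :=
  [set zeta | 1 < zeta /\
    exists n0 : int, forall n : int,
      n0 <= n -> dist_int (alpha * zeta ^ n) <= eps].

(* Main.v *)
(** If [alpha * z ^ n] sweeps [m - eps, m + eps] as [z] runs over an interval
    starting at [lo], then [alpha * z ^ n.+1] sweeps an interval of length at
    least [2 * eps * lo].  For [lo >= 1 + 1 / (2 * eps)] this contains some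
    [m' - eps, m' + eps] with [m'] an integer, and for [lo >= 1 + 1 / eps] it
    does so for two consecutive integers [m'].  Iterating gives nested
    intervals shrinking to a point of [chi eps alpha] in any prescribed
    interval; in the second case the free binary choices yield, for
    [eps < 1 / 2], a Cantor scheme of such points.  For [eps >= 1 / 2] every
    number larger than 1 belongs to [chi eps alpha]. *)

Require Import Defs.
From mathcomp Require Import all_boot all_order all_algebra.
From mathcomp Require Import all_classical all_reals all_analysis.
From mathcomp Require Import ring lra.

Set Implicit Arguments.
Unset Strict Implicit.
Unset Printing Implicit Defensive.

Import Order.TTheory GRing.Theory Num.Theory.
Import numFieldNormedType.Exports.

Local Open Scope classical_set_scope.
Local Open Scope ring_scope.

(** * Distance to the nearest integer, roots and growth of powers *)

Lemma dist_int_le (R : realType) (x e : R) (m : int) :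
  `|x - m%:~R| <= e -> dist_int x <= e.
Proof.
move=> h; apply: le_trans h; apply: ge_inf; last by exists m.
by exists 0 => _ [k _ <-].
Qed.

Lemma dist_int_half (R : realType) (x : R) : dist_int x <= 1 / 2.
Proof.
have := floor_itv (x + 1 / 2); rewrite intrD => /andP[h1 h2].
apply: (@dist_int_le _ _ _ (Num.floor (x + 1 / 2))).
rewrite ler_norml; apply/andP; split; lra.
Qed.

(** Explicit inverse of [z] to [alpha * z ^+ n] on nonnegative reals, for [n] and [alpha] positive;
    target intervals are pulled back through it. *)
Definition root_of (R : realType) (alpha : R) (n : nat) (y : R) : R :=
  (y / alpha) `^ n%:R^-1.

Lemma root_ofK (R : realType) (alpha y : R) (n : nat) :
  0 < alpha -> 0 <= y -> alpha * root_of alpha n.+1 y ^+ n.+1 = y.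
Proof.
move=> ha hy; rewrite /root_of -powR_mulrn ?powR_ge0// -powRrM mulVf ?pnatr_eq0//.
by rewrite powRr1 ?divr_ge0 ?(ltW ha)// mulrC divfK ?gt_eqF.
Qed.

Lemma ler_Mexp2l (R : realType) (alpha x y : R) (n : nat) :
  0 < alpha -> 0 <= x -> 0 <= y ->
  alpha * x ^+ n.+1 <= alpha * y ^+ n.+1 -> x <= y.
Proof. by move=> ha hx hy; rewrite ler_pM2l// ler_pXn2r. Qed.

(** A Bernoulli-type bound: since [c] and [d] are at least 1, each further factor adds at least
    [d - c]. *)
Lemma subrX_ge (R : realType) (c d : R) (n : nat) :
  1 <= c -> c <= d -> n%:R * (d - c) <= d ^+ n - c ^+ n.
Proof.
move=> hc hd; elim: n => [|n ih]; first by rewrite mul0r !expr0 subrr.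
have -> : d ^+ n.+1 - c ^+ n.+1 = d * (d ^+ n - c ^+ n) + (d - c) * c ^+ n.
  by rewrite !exprS; ring.
have h1 : 1 <= c ^+ n by rewrite exprn_ege1.
have h2 : c ^+ n <= d ^+ n by rewrite lerXn2r ?nnegrE//; lra.
rewrite -[n.+1]addn1 natrD; nra.
Qed.

(** * One refinement of an interval *)

(** The ceiling is the least integer [m] with [m - eps] not below [alpha * lo ^+ n]; [b] selects it
    or its successor. *)
Definition center (R : realType) (alpha eps lo : R) (n : nat) (b : bool) : int :=
  Num.ceil (alpha * lo ^+ n + eps) + b%:Z.

Definition refine (R : realType) (alpha eps : R) (n : nat) (b : bool)
    (I : R * R) : R * R :=
  let m := (center alpha eps I.1 n b)%:~R in
  (root_of alpha n (m - eps), root_of alpha n (m + eps)).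

(* Multiplying by [lo] stretches the range of [alpha * z ^+ n] from [2 * eps]
   to [2 * eps * lo >= 2 * eps + 1 + b], enough room for [1 + b] admissible
   centers. *)
Lemma refineP (R : realType) (alpha eps : R) (n : nat) (b : bool) (I : R * R) :
  0 < alpha -> 0 < eps -> 0 <= I.1 -> I.1 <= I.2 ->
  1 + b%:R <= 2 * eps * (I.1 - 1) ->
  2 * eps <= alpha * I.2 ^+ n - alpha * I.1 ^+ n ->
  let J := refine alpha eps n.+1 b I in
  let m : R := (center alpha eps I.1 n.+1 b)%:~R in
  [/\ I.1 <= J.1, J.1 <= J.2, J.2 <= I.2,
      alpha * J.1 ^+ n.+1 = m - eps & alpha * J.2 ^+ n.+1 = m + eps].
Proof.
case: I => lo hi /= ha he hlo hlh hb hw.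
set m : R := (center _ _ _ _ _)%:~R.
have hxn : 0 <= alpha * lo ^+ n.+1 by rewrite mulr_ge0 ?exprn_ge0// ltW.
have [hm1 hm2] : alpha * lo ^+ n.+1 + eps <= m /\
                 m <= alpha * lo ^+ n.+1 + eps + 1 + b%:R.
  have := ceil_itv (alpha * lo ^+ n.+1 + eps).
  rewrite intrB => /andP[h1 h2].
  have hb0 : 0 <= b%:R :> R by rewrite ler0n.
  by rewrite /m /center intrD -pmulrn; split; lra.
have hgrow : lo * (2 * eps) <= alpha * hi ^+ n.+1 - alpha * lo ^+ n.+1.
  have hhi : 0 <= alpha * hi ^+ n by rewrite mulr_ge0 ?exprn_ge0//; lra.
  have -> : alpha * hi ^+ n.+1 - alpha * lo ^+ n.+1 =
    lo * (alpha * hi ^+ n - alpha * lo ^+ n) + (hi - lo) * (alpha * hi ^+ n).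
    by rewrite !exprS; ring.
  nra.
have e1 : alpha * root_of alpha n.+1 (m - eps) ^+ n.+1 = m - eps.
  by apply: root_ofK => //; lra.
have e2 : alpha * root_of alpha n.+1 (m + eps) ^+ n.+1 = m + eps.
  by apply: root_ofK => //; lra.
have p1 : 0 <= root_of alpha n.+1 (m - eps) by exact: powR_ge0.
have p2 : 0 <= root_of alpha n.+1 (m + eps) by exact: powR_ge0.
split => //; apply: (@ler_Mexp2l _ alpha _ _ n) => //; rewrite ?e1 ?e2; lra.
Qed.

(** * Nested intervals and their limit point *)

Fixpoint nest (R : realType) (alpha eps : R) (N : nat) (I : R * R)
    (b : nat -> bool) (i : nat) : R * R :=
  if i is j.+1 then refine alpha eps (N + j).+1 (b j) (nest alpha eps N I b j)
  else I.

Definition nestable (R : realType) (alpha eps : R) (N : nat) (I : R * R)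
    (b : nat -> bool) : Prop :=
  [/\ 0 < alpha, 0 < eps, 1 <= I.1 <= I.2,
      forall i, 1 + (b i)%:R <= 2 * eps * (I.1 - 1) &
      2 * eps <= alpha * I.2 ^+ N - alpha * I.1 ^+ N].

(** The spread is assumed at [i = 0] and equals [2 * eps] after each refinement. Left ends never
    decrease, so the bound on [b] at [I.1] persists. *)
Lemma nest_inv (R : realType) (alpha eps : R) (N : nat) (I : R * R)
    (b : nat -> bool) (i : nat) :
  nestable alpha eps N I b -> let J := nest alpha eps N I b i in
  [/\ I.1 <= J.1, J.1 <= J.2 &
      2 * eps <= alpha * J.2 ^+ (N + i) - alpha * J.1 ^+ (N + i)].
Proof.
case=> ha he /andP[h1 hI] hb hw; elim: i => [|i [ih1 ih2 ih3]] /=.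
  by rewrite addn0.
have hbi := hb i.
have [] := @refineP R alpha eps (N + i) (b i) _ ha he _ ih2 _ ih3.
- lra.
- by apply: le_trans hbi _; rewrite ler_pM2l; lra.
move=> g1 g2 _ e1 e2; rewrite addnS e1 e2; split=> //; last by lra.
exact: le_trans ih1 g1.
Qed.

Lemma nestS (R : realType) (alpha eps : R) (N : nat) (I : R * R)
    (b : nat -> bool) (i : nat) :
  nestable alpha eps N I b ->
  let J := nest alpha eps N I b i in let K := nest alpha eps N I b i.+1 in
  let m : R := (center alpha eps J.1 (N + i).+1 (b i))%:~R in
  [/\ J.1 <= K.1, K.2 <= J.2, alpha * K.1 ^+ (N + i).+1 = m - eps &
      alpha * K.2 ^+ (N + i).+1 = m + eps].
Proof.
move=> h; have [h1 h2 h3] := @nest_inv _ _ _ _ _ _ i h.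
case: h => ha he /andP[hI _] hb _; have hbi := hb i.
have [] := @refineP R alpha eps (N + i) (b i) _ ha he _ h2 _ h3.
- lra.
- by apply: le_trans hbi _; rewrite ler_pM2l; lra.
by [].
Qed.

Definition nest_pt (R : realType) (alpha eps : R) (N : nat) (I : R * R)
    (b : nat -> bool) : R :=
  sup (range (fun i => (nest alpha eps N I b i).1)).

Lemma nest_pt_in (R : realType) (alpha eps : R) (N : nat) (I : R * R)
    (b : nat -> bool) (i : nat) :
  nestable alpha eps N I b -> let J := nest alpha eps N I b i in
  J.1 <= nest_pt alpha eps N I b <= J.2.
Proof.
move=> h.
pose lo i := (nest alpha eps N I b i).1; pose hi i := (nest alpha eps N I b i).2.
have hlo : {homo lo : p q / (p <= q)%N >-> p <= q}.
  by apply/nondecreasing_seqP => p; have [] := @nestS _ _ _ _ _ _ p h.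
have hhi : {homo hi : p q / (p <= q)%N >-> q <= p}.
  by apply/nonincreasing_seqP => p; have [] := @nestS _ _ _ _ _ _ p h.
(* Both ends are compared with those of the interval at index [maxn p q]. *)
have ub p q : lo q <= hi p.
  have [_ hm _] := @nest_inv _ _ _ _ _ _ (maxn p q) h.
  apply: le_trans (hlo _ _ (leq_maxr p q)) _.
  exact: le_trans hm (hhi _ _ (leq_maxl p q)).
apply/andP; split.
- apply: ub_le_sup; last by exists i.
  by exists (hi i) => _ [q _ <-]; exact: ub.
- apply: ge_sup; first by exists (lo 0); exists 0.
  by move=> _ [q _ <-]; exact: ub.
Qed.

Lemma nest_pt_approx (R : realType) (alpha eps : R) (N : nat) (I : R * R)
    (b : nat -> bool) (i : nat) :
  nestable alpha eps N I b ->
  `|alpha * nest_pt alpha eps N I b ^+ (N + i).+1 -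
    (center alpha eps (nest alpha eps N I b i).1 (N + i).+1 (b i))%:~R| <= eps.
Proof.
move=> h; have [_ _ e1 e2] := @nestS _ _ _ _ _ _ i h.
have /andP[h1 h2] := @nest_pt_in _ _ _ _ _ _ i.+1 h.
have [g1 _ _] := @nest_inv _ _ _ _ _ _ i.+1 h.
case: h => ha _ /andP[hI _] _ _.
rewrite ler_norml; apply/andP; split.
- rewrite lerBrDl -e1 ler_pM2l// lerXn2r ?nnegrE//; lra.
- rewrite lerBlDl -e2 ler_pM2l// lerXn2r ?nnegrE//; lra.
Qed.

Lemma chi_nest_pt (R : realType) (alpha eps : R) (N : nat) (I : R * R)
    (b : nat -> bool) :
  nestable alpha eps N I b -> chi eps alpha (nest_pt alpha eps N I b).
Proof.
move=> h; split.
  have /andP[/= h1 _] := @nest_pt_in _ _ _ _ _ _ 0 h.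
  case: h => _ he _ hb _; have := hb 0; have : 0 <= (b 0)%:R :> R by rewrite ler0n.
  nra.
(* The initial interval has no center, so the approximation starts at exponent [N.+1]; this also
   rules out negative [n]. *)
exists N.+1%:Z => -[] // n; rewrite lez_nat => hn.
have := @nest_pt_approx _ _ _ _ _ _ (n - N.+1) h.
rewrite -addSn subnKC//; exact: dist_int_le.
Qed.

(* Here [eps < 1 / 2] makes the intervals around two successive centers
   disjoint, so the limit point remembers every choice. *)
Lemma nest_pt_inj (R : realType) (alpha eps : R) (N : nat) (I : R * R)
    (b b' : nat -> bool) :
  eps < 1 / 2 -> nestable alpha eps N I b -> nestable alpha eps N I b' ->
  nest_pt alpha eps N I b = nest_pt alpha eps N I b' -> b = b'.
Proof.
move=> he h h' eqz.
have same i : nest alpha eps N I b i = nest alpha eps N I b' i -> b i = b' i.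
  move=> e; have := @nest_pt_approx _ _ _ _ _ _ i h.
  have := @nest_pt_approx _ _ _ _ _ _ i h'.
  rewrite -eqz -e /center !intrD -!pmulrn !ler_norml.
  move: (alpha * _) (Num.ceil _)%:~R => u v.
  by case: (b i) (b' i) => -[] //= /andP[? ?] /andP[? ?]; exfalso; lra.
have eqn i : nest alpha eps N I b i = nest alpha eps N I b' i.
  by elim: i => [//|i ih] /=; rewrite ih same.
by apply/funext => i; exact: same.
Qed.

(** Here [k] bounds the number of choices per step: 1 for density, 2 for cardinality. [N] is
    independent of [b], so all choice sequences share one scheme. *)
Lemma ex_nestable (R : realType) (alpha eps c d k : R) :
  0 < alpha -> 0 < eps -> 0 < k -> 1 + k / (2 * eps) <= c -> c < d ->
  exists N, forall b : nat -> bool, (forall i, 1 + (b i)%:R <= k) ->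
    nestable alpha eps N (c, d) b.
Proof.
move=> ha he hk hc hcd.
have hkc : k <= 2 * eps * (c - 1).
  by rewrite mulrC -ler_pdivrMr; lra.
have c1 : 1 <= c by apply: le_trans hc; rewrite lerDl divr_ge0; lra.
have had : 0 < alpha * (d - c) by rewrite mulr_gt0// subr_gt0.
pose N := Num.bound (2 * eps / (alpha * (d - c))).
exists N => b hb; split => //=.
- by rewrite c1 ltW.
- by move=> i; apply: le_trans hkc.
have /archi_boundP : 0 <= 2 * eps / (alpha * (d - c)).
  by rewrite divr_ge0 ?(ltW had)//; lra.
rewrite -/N ltr_pdivrMr// => hN.
have hX := @subrX_ge R c d N c1 (ltW hcd).
rewrite -mulrBr; apply: le_trans (ltW hN) _.
by rewrite mulrCA ler_pM2l.
Qed.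

(** * Sets with the cardinality of the reals *)

Lemma card_eq_setT_of_inj (R : Type) (A : set R) (f : R -> R) :
  injective f -> (forall x, A (f x)) -> (A #= [set: R])%card.
Proof.
move=> finj fA; apply: Cantor_Bernstein.
  exact: subset_card_le.
have /(card_le_eql) <- : (f @` [set: R] #= [set: R])%card.
  by apply: inj_card_eq => x y _ _; exact: finj.
by apply: subset_card_le => _ [x _ <-].
Qed.

(** The Dedekind cut of [x] as a binary sequence, through an enumeration of the rationals; it turns
    reals into choice sequences. *)
Definition rat_cut (R : realType) (x : R) (n : nat) : bool :=
  if unpickle n is Some q then ratr q < x else false.

Lemma rat_cut_inj (R : realType) : injective (@rat_cut R).
Proof.
suff lt_neq (x y : R) : x < y -> rat_cut x <> rat_cut y :> (nat -> bool).
  move=> x y exy; apply/eqP; rewrite eq_le !leNgt; apply/andP; split.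
    by apply/negP => /lt_neq; rewrite exy.
  by apply/negP => /lt_neq; rewrite exy.
move=> xy e; have [q] := rat_in_itvoo xy; rewrite in_itv /= => /andP[h1 h2].
have := congr1 (fun f => f (pickle q)) e.
by rewrite /rat_cut pickleK h2 ltNge (ltW h1).
Qed.

Lemma card_itvoo_sub (R : realType) (c d : R) (A : set R) :
  c < d -> `]c, d[%classic `<=` A -> (A #= [set: R])%card.
Proof.
move=> cd sA.
(* [contract] injects the reals into the open interval from -1 to 1, which an affine map carries to
   []c, d[]. *)
apply: (@card_eq_setT_of_inj _ _
  (fun x : R => (c + d) / 2 + (d - c) / 2 * contract x%:E)).
  have dc : (d - c) / 2 != 0 by rewrite gt_eqF//; lra.
  by move=> x y /addrI /(mulfI dc) /contract_inj [].
move=> x; have := contract_lt1 x.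
move: (contract _) => t; rewrite ltr_norml => /andP[h1 h2]; apply: sA.
by rewrite /= in_itv /=; apply/andP; split; nra.
Qed.

Lemma chi_large_eps (R : realType) (alpha eps zeta : R) :
  1 / 2 <= eps -> 1 < zeta -> chi eps alpha zeta.
Proof.
move=> he hz; split => //; exists 0 => n _.
exact: le_trans (dist_int_half _) he.
Qed.

Theorem theorem3p3 (R : realType) (alpha eps : R)
    (halpha : 0 < alpha) (heps : 0 < eps) :
  (`]1 + 1 / (2 * eps), +oo[%classic `<=`
     closure (chi eps alpha `&` `]1 + 1 / (2 * eps), +oo[%classic)) /\
  (forall a b : R, Num.max a (1 + 1 / eps) < b ->
     ((chi eps alpha `&` `]a, b[%classic) #= [set: R])%card).
Proof.
split.
- move=> x /=; rewrite in_itv /= andbT => hx B /nbhs_ballP[r /= r0 hr].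
  have [N hN] := @ex_nestable R alpha eps x (x + r / 2) 1 halpha heps
    ltr01 (ltW hx) ltac:(lra).
  have h := hN (fun=> false) ltac:(by move=> i; rewrite addr0).
  have /andP[/= h1 h2] := @nest_pt_in _ _ _ _ _ _ 0 h.
  exists (nest_pt alpha eps N (x, x + r / 2) (fun=> false)); split.
    split; first exact: chi_nest_pt.
    by rewrite /= in_itv /= andbT; exact: lt_le_trans h1.
  apply: hr; rewrite /ball /= ler0_norm; lra.
move=> a b; set M := Num.max _ _ => hM.
have Ma : a <= M by rewrite /M le_max lexx.
have M1 : 1 + 1 / eps <= M by rewrite /M le_max lexx orbT.
have eps1 : 0 < 1 / eps by rewrite divr_gt0.
have [he|he] := leP (1 / 2) eps.
  apply: (@card_itvoo_sub _ M b) => // z /=; rewrite in_itv /= => /andP[h1 h2].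
  split; first by apply: chi_large_eps => //; lra.
  by rewrite /= in_itv /=; apply/andP; split; lra.
(* The middle third of []M, b[]: limit points lie in the closed interval from [c] to [d], hence
   strictly between [a] and [b]. *)
pose c := (2 * M + b) / 3; pose d := (M + 2 * b) / 3.
have hc : 1 + 2 / (2 * eps) <= c.
  have -> : 2 / (2 * eps) = 1 / eps by field; rewrite gt_eqF.
  rewrite /c; lra.
have [N hN] := @ex_nestable R alpha eps c d 2 halpha heps ltac:(lra) hc
  ltac:(rewrite /c /d; lra).
have h (x : R) : nestable alpha eps N (c, d) (rat_cut x).
  by apply: hN => i; case: rat_cut => /=; lra.
apply: (@card_eq_setT_of_inj _ _
  (fun x => nest_pt alpha eps N (c, d) (rat_cut x))).
  move=> x y exy; apply: rat_cut_inj.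
  exact: nest_pt_inj he (h x) (h y) exy.
move=> x; split; first exact: chi_nest_pt.
have /andP[/= h1 h2] := @nest_pt_in _ _ _ _ _ _ 0 (h x).
rewrite /= in_itv /=; apply/andP; split; rewrite /c /d in h1 h2; lra.
Qed.
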